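(* Let $p$ be a prime, let $n\ge 3$ and $j\ge 2$ be integers, and let $\Gamma=\mathbb{Z}_p^j$. For each integer $i$ with $1\le i\le j$, there is a rank-$i$ lift $M$ of the graphic matroid $M(K_n^{\Gamma})$ so that a cycle of $K_n^{\Gamma}$ is a circuit of $M$ if and only if it is balanced.
   Context: $\mathbb{Z}_p^j$ is the direct sum of $j$ copies of the cyclic group of order $p$. For a finite group $\Gamma$ and integer $n\ge 3$, $K_n^{\Gamma}$ is the (multi)graph with vertex set $[n]=\{1,\dots,n\}$ and edge set $\binom{[n]}{2}\times\Gamma$, where the edge $(\{i,j\},\alpha)$ joins vertices $i$ and $j$. For $i<j$ the edge $e=(\{i,j\},\alpha)$ is oriented from $i$ to $j$ and has label $\phi(e)=\alpha$. For a walk $W$ with edge sequence $e_1,\dots,e_k$, put $\phi(W)=\prod_{t=1}^k\phi(e_t)^{c_t}$ (group written multiplicatively), where $c_t=1$ if $e_t$ is traversed forward in $W$ and $c_t=-1$ if it is traversed backward. A cycle $C$ of $K_n^{\Gamma}$ (including cycles consisting of two parallel edges) is balanced if some (equivalently, every) simple closed walk $W$ around $C$ has $\phi(W)$ equal to the identity of $\Gamma$. Cycles are identified with their edge sets. $M(G)$ is the graphic (cycle) matroid of a graph $G$. A matroid $K$ is a lift of a matroid $M$ if there is a matroid $P$ and a subset $X$ of $E(P)$ so that $P\setminus X=K$ and $P/X=M$. If $r(K)-r(M)=k$, then $K$ is a rank-$k$ lift of $M$. *)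

(* Defs.v *)
From mathcomp Require Import all_boot all_order all_algebra all_fingroup.

Set Implicit Arguments.
Unset Strict Implicit.
Unset Printing Implicit Defensive.

(* The ground set of a matroid is the whole finType T; restrictions of the
   ground set are expressed by passing to a subtype. *)
Record matroid (T : finType) := Matroid {
  indep : pred {set T};
  indep0 : indep set0;
  indepS : forall A B : {set T}, A \subset B -> indep B -> indep A;
  indep_aug : forall A B : {set T}, indep A -> indep B -> #|A| < #|B| ->
    exists2 x, x \in B :\: A & indep (x |: A) }.

Definition circuit (T : finType) (M : matroid T) (C : {set T}) : bool :=
  minset (fun A => ~~ indep M A) C.

Definition rk (T : finType) (M : matroid T) (S : {set T}) : nat :=
  \max_(A : {set T} | (A \subset S) && indep M A) #|A|.

Definition rank (T : finType) (M : matroid T) : nat := rk M [set: T].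

Section Minors.

Variables (T : finType) (P : matroid T) (X : {set T}).

Lemma rk_witness (S : {set T}) :
  exists A : {set T}, [/\ A \subset S, indep P A & #|A| = rk P S].
Proof.
have H0 : (set0 \subset S) && indep P set0 by rewrite sub0set indep0.
rewrite /rk (bigmax_eq_arg set0 H0).
by case: arg_maxnP => // A /andP[sAS iA] _; exists A.
Qed.

Lemma indep_card_rk (A S : {set T}) : A \subset S -> indep P A -> #|A| <= rk P S.
Proof.
move=> sAS iA; rewrite /rk (bigD1 A) ?sAS //=; exact: leq_maxl.
Qed.

Lemma rkU_card (Y Z : {set T}) : rk P (Z :|: Y) <= #|Z| + rk P Y.
Proof.
have [I [sI iI <-]] := rk_witness (Z :|: Y).
rewrite -(cardsID Y I) addnC leq_add //.
  apply: subset_leq_card; apply/subsetP => x; rewrite inE => /andP[xY xI].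
  by have := subsetP sI x xI; rewrite inE (negPf xY) orbF.
by apply: indep_card_rk; rewrite ?subsetIr //; apply: indepS iI; rewrite subsetIl.
Qed.

Local Notation T' := {x : T | x \notin X}.

Definition delete_indep (A : {set T'}) : bool := indep P (val @: A).

Lemma delete_indep0 : delete_indep set0.
Proof. by rewrite /delete_indep imset0 indep0. Qed.

Lemma delete_indepS (A B : {set T'}) :
  A \subset B -> delete_indep B -> delete_indep A.
Proof. by move=> sAB; apply: indepS; apply: imsetS. Qed.

Lemma delete_indep_aug (A B : {set T'}) :
  delete_indep A -> delete_indep B -> #|A| < #|B| ->
  exists2 x, x \in B :\: A & delete_indep (x |: A).
Proof.
move=> iA iB ltAB; have := indep_aug iA iB.
rewrite !card_imset; try exact: val_inj.
case=> // _ /setDP[/imsetP[x xB ->]]; rewrite mem_imset; last exact: val_inj.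
by move=> xA ixA; exists x; [rewrite inE xA | rewrite /delete_indep imsetU1].
Qed.

Definition delete : matroid T' :=
  Matroid delete_indep0 delete_indepS delete_indep_aug.

(* A is independent in P / X iff r(A :|: X) - r(X) = #|A|. *)
Definition contract_indep (A : {set T'}) : bool :=
  rk P (val @: A :|: X) == #|A| + rk P X.

Lemma contract_indep0 : contract_indep set0.
Proof. by rewrite /contract_indep imset0 set0U cards0. Qed.

Lemma contract_rk_le (A : {set T'}) : rk P (val @: A :|: X) <= #|A| + rk P X.
Proof.
by rewrite -[in leqRHS](card_imset (mem A) val_inj); apply: rkU_card.
Qed.

Lemma contract_indepS (A B : {set T'}) :
  A \subset B -> contract_indep B -> contract_indep A.
Proof.
move=> sAB /eqP rB; rewrite /contract_indep eqn_leq contract_rk_le /=.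
have DA : val @: (B :\: A) :|: (val @: A :|: X) = val @: B :|: X.
  by rewrite setUA -imsetU setUC -{2}(setID B A) (setIidPr sAB) [A :|: _]setUC setUC.
have := rkU_card (val @: A :|: X) (val @: (B :\: A)).
rewrite DA rB card_imset; last exact: val_inj.
by rewrite -(cardsID A B) (setIidPr sAB) [#|A| + _]addnC -addnA leq_add2l.
Qed.

Lemma contract_indep_aug (A B : {set T'}) :
  contract_indep A -> contract_indep B -> #|A| < #|B| ->
  exists2 x, x \in B :\: A & contract_indep (x |: A).
Proof.
move=> /eqP rA /eqP rB ltAB.
have [I [sI iI cI]] := rk_witness (val @: A :|: X).
have [J [sJ iJ cJ]] := rk_witness (val @: B :|: X).
have [|y /setDP[yJ yI] iyI] := indep_aug iI iJ.
  by rewrite cI cJ rA rB ltn_add2r.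
have yA : y \notin val @: A :|: X.
  apply/negP => yA.
  have := indep_card_rk (_ : y |: I \subset val @: A :|: X) iyI.
  by rewrite subUset sub1set yA sI cardsU1 yI cI add1n ltnn => /(_ isT).
have /setUP[/imsetP[x xB yx]|yX] := subsetP sJ y yJ; last first.
  by rewrite inE yX orbT in yA.
have xA : x \notin A.
  by apply: contra yA => xA; rewrite inE yx imset_f.
exists x; first by rewrite inE xA.
rewrite /contract_indep eqn_leq contract_rk_le /= cardsU1 xA -addnA -rA -cI.
rewrite -yI -cardsU1; apply: indep_card_rk => //.
by rewrite imsetU1 -yx -setUA setUS.
Qed.

Definition contract : matroid T' :=
  Matroid contract_indep0 contract_indepS contract_indep_aug.

End Minors.

(* N is the matroid M with its elements renamed by the bijection f. *)
Definition renaming (S T : finType) (f : S -> T) (M : matroid S) (N : matroid T)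
    : Prop :=
  bijective f /\ forall A : {set S}, indep N (f @: A) = indep M A.

(* The ground set E of K and M is identified, by one bijection f used for both
   K and M, with the complement of X in the ground set of P. *)
Definition is_lift (E : finType) (K M : matroid E) : Prop :=
  exists (T : finType) (P : matroid T) (X : {set T})
         (f : E -> {x : T | x \notin X}),
    renaming f K (delete P X) /\ renaming f M (contract P X).

Definition is_rank_lift (k : nat) (E : finType) (K M : matroid E) : Prop :=
  is_lift K M /\ rank K = rank M + k.

(* Loops and parallel edges are allowed. The order of the two ends is only a
   reference orientation of the edges of the undirected graph. *)
Record multigraph (V E : finType) := Multigraph { src : E -> V; tgt : E -> V }.

Section Graph.

Variables (V E : finType) (G : multigraph V E).

(* A dart (e, true) is e traversed forward, (e, false) is e traversed backward.
   A closed walk is represented by its sequence of darts. *)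
Definition dsrc (d : E * bool) : V := if d.2 then src G d.1 else tgt G d.1.
Definition dtgt (d : E * bool) : V := if d.2 then tgt G d.1 else src G d.1.

Definition wedges (w : seq (E * bool)) : {set E} := [set e in map fst w].

(* The condition on edges excludes traversing one edge back and forth. *)
Definition simple_closed_walk (w : seq (E * bool)) : bool :=
  [&& w != [::], path.cycle (fun d d' => dtgt d == dsrc d') w,
      uniq (map dsrc w) & uniq (map fst w)].

(* A simple closed walk around C has exactly #|C| darts; see is_cycleP. *)
Definition is_cycle (C : {set E}) : bool :=
  [exists w : #|C|.-tuple (E * bool), simple_closed_walk w && (wedges w == C)].

Lemma is_cycleP (C : {set E}) :
  reflect (exists2 w, simple_closed_walk w & wedges w = C) (is_cycle C).
Proof.
apply: (iffP existsP) => [[w /andP[cw /eqP wC]]|[w cw wC]]; first by exists w.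
have sw : size w == #|C|.
  by rewrite -wC cardsE; have /and4P[_ _ _ /card_uniqP->] := cw; rewrite size_map.
by exists (Tuple sw); rewrite cw /= wC eqxx.
Qed.

Definition acyclic (A : {set E}) : bool :=
  [forall C : {set E}, is_cycle C ==> ~~ (C \subset A)].

Lemma acyclicP (A : {set E}) :
  reflect (forall w, simple_closed_walk w -> ~~ (wedges w \subset A)) (acyclic A).
Proof.
apply: (iffP forallP) => [aA w cw|aA C].
  by apply: (implyP (aA _)); apply/is_cycleP; exists w.
by apply/implyP => /is_cycleP[w cw <-]; apply: aA.
Qed.

Definition adj (A : {set E}) : rel V := fun x y =>
  [exists d : E * bool, [&& d.1 \in A, dsrc d == x & dtgt d == y]].

Lemma adj_dart (A : {set E}) (d : E * bool) : d.1 \in A -> adj A (dsrc d) (dtgt d).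
Proof. by move=> dA; apply/existsP; exists d; rewrite dA !eqxx. Qed.

Lemma adj_sym (A : {set E}) : symmetric (adj A).
Proof.
suff H x y : adj A x y -> adj A y x by move=> x y; apply/idP/idP; apply: H.
by case/existsP=> -[e b] /and3P[/= eA /eqP<- /eqP<-]; apply/existsP;
  exists (e, ~~ b); case: b; rewrite /= eA !eqxx.
Qed.

Lemma adj_connect_sym (A : {set E}) : connect_sym (adj A).
Proof. by apply: sym_connect_sym; apply: adj_sym. Qed.

Lemma connect_darts (A : {set E}) d w :
  all (fun d => d.1 \in A) w -> path (fun d d' => dtgt d == dsrc d') d w ->
  connect (adj A) (dtgt d) (dtgt (last d w)).
Proof.
elim: w d => [|d' w IHw] d //= /andP[dA wA] /andP[/eqP-> pw].
by apply: connect_trans (IHw d' wA pw); apply: connect1; apply: adj_dart.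
Qed.

Lemma cycle_connect (A : {set E}) e :
  acyclic A -> ~~ acyclic (e |: A) -> connect (adj A) (src G e) (tgt G e).
Proof.
move=> /acyclicP aA /forallPn[C]; rewrite negb_imply negbK.
case/andP=> /is_cycleP[w cw <-] swA.
have ew : e \in map fst w.
  apply: contraR (aA w cw) => ew; apply/subsetP=> x xw.
  have := subsetP swA x xw; rewrite !inE => /orP[/eqP xe|//].
  by move: xw; rewrite inE xe (negPf ew).
case/mapP: ew => d dw ed.
have [_ cyw _ uw] := and4P cw.
have [i w' rw] := rot_to dw.
have : uniq (map fst (d :: w')) by rewrite -rw map_rot rot_uniq.
have : path.cycle (fun d d' => dtgt d == dsrc d') (d :: w') by rewrite -rw rot_cycle.
rewrite /= rcons_path => /andP[pw /eqP dl] /andP[dw' _].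
have wA : all (fun d => d.1 \in A) w'.
  apply/allP=> f fw'.
  have fw : f.1 \in map fst w.
    by apply: map_f; rewrite -(mem_rot i) rw inE fw' orbT.
  have := subsetP swA f.1; rewrite !inE fw => /(_ isT) /orP[/eqP fe|//].
  by case/negP: dw'; rewrite -ed -fe; apply: map_f.
have := connect_darts wA pw; rewrite dl ed {rw pw dl}.
by case: d {dw ed dw'} => e' [] //=; rewrite /dsrc /dtgt //= adj_connect_sym.
Qed.

Lemma path_darts (A : {set E}) x s : path (adj A) x s -> uniq (x :: s) ->
  exists w : seq (E * bool),
    [/\ all (fun d => d.1 \in A) w, map dsrc w = belast x s,
        map dtgt w = s & uniq (map fst w)].
Proof.
elim: s x => [|y s IHs] x /=; first by exists [::].
case/andP=> /existsP[d /and3P[dA /eqP dx /eqP dy]] ps /andP[xs us].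
have [w [wA wsrc wtgt uw]] := IHs y ps us.
exists (d :: w); split; rewrite /= ?dA ?dx ?dy ?wsrc ?wtgt ?uw ?andbT //.
apply: contra xs => /mapP[f fw df].
have f1 : dsrc f \in y :: s.
  by apply: mem_belast; rewrite -wsrc; apply: map_f.
have f2 : dtgt f \in y :: s.
  by rewrite inE -[in X in _ || X]wtgt map_f ?orbT.
suff [<-|<-] : dsrc f = x \/ dtgt f = x by [].
rewrite -dx; case: d f df {dx dy dA fw f1 f2} => [e b] [e' b'] /= ->.
by rewrite /dsrc /dtgt /=; case: b b' => -[]; auto.
Qed.

Lemma darts_path d w : map dsrc w = belast (dtgt d) (map dtgt w) ->
  path (fun d d' => dtgt d == dsrc d') d w.
Proof. by elim: w d => //= d' w IHw d [-> /IHw->]; rewrite eqxx. Qed.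

Lemma acyclic_disconnect (A : {set E}) e : e \notin A -> acyclic (e |: A) ->
  ~~ connect (adj A) (src G e) (tgt G e).
Proof.
move=> eA /acyclicP aeA; rewrite adj_connect_sym.
apply/negP => /connectP[s0 ps0]; case/shortenP: ps0 => s ps us _ ls.
have [w [wA wsrc wtgt uw]] := path_darts ps us.
have ew : e \notin map fst w.
  by apply: contra eA => /mapP[d dw ->]; apply: (allP wA).
have cw : simple_closed_walk ((e, true) :: w).
  apply/and4P; split => //=; last by rewrite ew.
    rewrite rcons_path darts_path ?wsrc ?wtgt //=.
    by rewrite -(last_map dtgt) wtgt /dsrc /dtgt /= ls; apply/eqP.
  rewrite wsrc {1}/dsrc /= ls.
  by move: us; rewrite lastI rcons_uniq.
case/negP: (aeA _ cw); apply/subsetP=> x; rewrite !inE /=.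
case/orP=> [->//|/mapP[d dw ->]].
by rewrite (allP wA _ dw) orbT.
Qed.

(* The functions V -> bool constant on the components of (V, A). *)
Let cuts (A : {set E}) : {set {ffun V -> bool}} :=
  [set g : {ffun V -> bool} | [forall e in A, g (src G e) == g (tgt G e)]].

Let cutsP (A : {set E}) (g : {ffun V -> bool}) :
  reflect (forall x y, connect (adj A) x y -> g x = g y) (g \in cuts A).
Proof.
rewrite inE; apply: (iffP forall_inP) => [gA x y|gA e eA]; last first.
  by apply/eqP; apply: gA; apply: connect1; exact: (@adj_dart A (e, true)).
case/connectP=> s ps ->; elim: s x ps => //= z s IHs x /andP[/existsP[d]].
case/and3P=> dA /eqP<- /eqP<- /IHs <-; have /eqP := gA _ dA.
by rewrite /dsrc /dtgt; case: d.2.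
Qed.

Let card_cuts (A : {set E}) : acyclic A -> #|cuts A| * 2 ^ #|A| = 2 ^ #|V|.
Proof.
elim: {A}_.+1 {-2}A (ltnSn #|A|) => // m IHm A; rewrite ltnS => leAm aA.
have [->|[e eA]] := set_0Vmem A.
  rewrite cards0 muln1 -card_bool -card_ffun -cardsT; congr #|pred_of_set _|.
  by apply/setP=> g; rewrite !inE; apply/forall_inP=> e; rewrite inE.
have DA := setD1K eA; rewrite -DA in aA.
have eB : e \notin A :\ e by rewrite !inE eqxx.
have nuv := acyclic_disconnect eB aA.
have aB : acyclic (A :\ e).
  apply/acyclicP=> w /(acyclicP _ aA); apply: contra => /subset_trans; apply.
  exact: subsetUr.
have ltBm : #|A :\ e| < m by move: leAm; rewrite (cardsD1 e A) eA.
rewrite -(IHm _ ltBm aB) (cardsD1 e A) eA.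
rewrite expnD mulnA; congr (_ * _).
set B := A :\ e in eB nuv aB *; set u := src G e in nuv *.
pose D : {set {ffun V -> bool}} :=
    [set g : {ffun V -> bool} | g u == g (tgt G e)].
have cA : cuts A = cuts B :&: D.
  apply/setP=> g; rewrite -DA 3!inE [X in _ && X]inE; apply/forall_inP/andP.
    move=> gA; split; last by apply: gA; rewrite setU11.
    by apply/forall_inP=> f fB; apply: gA; rewrite setU1r.
  by case=> /forall_inP gB gu f /setU1P[->|/gB].
pose flip (g : {ffun V -> bool}) := [ffun x => g x (+) connect (adj B) u x].
have flipK : involutive flip.
  by move=> g; apply/ffunP=> x; rewrite !ffunE addbK.
have flipB g : (flip g \in cuts B) = (g \in cuts B).
  suff H h : h \in cuts B -> flip h \in cuts B.
    by apply/idP/idP => [/H|/H //]; rewrite flipK.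
  move=> /cutsP hB; apply/cutsP=> x y xy; rewrite !ffunE (hB x y xy).
  by rewrite (same_connect_r (@adj_connect_sym B) xy).
have cD : #|cuts B :\: D| = #|cuts A|.
  rewrite cA -(card_imset _ (inv_inj flipK)); congr #|pred_of_set _|.
  apply/setP=> g; rewrite -{1}[g]flipK mem_imset; last exact: inv_inj.
  have inD h : (h \in D) = (h u == h (tgt G e)) by rewrite inE.
  rewrite in_setD in_setI flipB !inD !ffunE connect0 (negPf nuv) andbC.
  by case: (g u); case: (g _).
by rewrite -(cardsID D (cuts B)) cD cA expn1 muln2 -addnn.
Qed.

Let graphic_indep0 : acyclic set0.
Proof.
apply/acyclicP=> w cw; rewrite subset0; apply/set0Pn.
by case: w cw => // d w _; exists d.1; rewrite inE mem_head.
Qed.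

Let graphic_indepS (A B : {set E}) : A \subset B -> acyclic B -> acyclic A.
Proof.
move=> sAB /acyclicP aB; apply/acyclicP=> w /aB.
by apply: contra => /subset_trans; apply.
Qed.

Let graphic_indep_aug (A B : {set E}) :
  acyclic A -> acyclic B -> #|A| < #|B| ->
  exists2 x, x \in B :\: A & acyclic (x |: A).
Proof.
move=> aA aB ltAB.
have [/exists_inP//|noe] := boolP [exists x in B :\: A, acyclic (x |: A)].
have sAB : cuts A \subset cuts B.
  apply/subsetP=> g /cutsP gA; rewrite inE; apply/forall_inP=> e eB.
  apply/eqP; apply: gA; have [eA|eA] := boolP (e \in A).
    by apply: connect1; exact: (@adj_dart A (e, true)).
  apply: cycle_connect => //; apply: contra noe => aeA.
  by apply/exists_inP; exists e; rewrite // inE eA.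
have := subset_leq_card sAB.
rewrite leqNgt => /negP[].
rewrite -(ltn_pmul2r (expn_gt0 2 #|B|)) (card_cuts aB) -(card_cuts aA).
have : 0 < #|cuts A|.
  by have := expn_gt0 2 #|V|; rewrite -(card_cuts aA) muln_gt0 => /andP[].
by move=> c0; rewrite ltn_pmul2l // ltn_exp2l.
Qed.

Definition graphic : matroid E :=
  Matroid graphic_indep0 graphic_indepS graphic_indep_aug.

End Graph.

Section GroupLabelling.

Local Open Scope group_scope.

Variables (V E : finType) (gT : finGroupType) (G : multigraph V E) (phi : E -> gT).

Definition walk_label (w : seq (E * bool)) : gT :=
  \prod_(d <- w) (if d.2 then phi d.1 else (phi d.1)^-1).

Definition balanced (C : {set E}) : Prop :=
  exists w, [/\ simple_closed_walk G w, wedges w = C & walk_label w = 1].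

End GroupLabelling.

(* The edge ({i, j}, alpha) with i < j is encoded as ((i, j), alpha). *)
Definition Kedge (n : nat) (gT : finGroupType) : finType :=
  ({ij : 'I_n * 'I_n | ij.1 < ij.2} * gT)%type.

Definition Kgraph (n : nat) (gT : finGroupType) : multigraph 'I_n (Kedge n gT) :=
  Multigraph (fun e => (val e.1).1) (fun e => (val e.1).2).

Definition Klabel (n : nat) (gT : finGroupType) (e : Kedge n gT) : gT := e.2.

(* Main.v *)
Require Import Defs.
From HB Require Import structures.
From mathcomp Require Import all_boot all_order all_algebra all_fingroup.

Set Implicit Arguments.
Unset Strict Implicit.
Unset Printing Implicit Defensive.

Import GRing.Theory.

(** The lift is represented over a field of characteristic p. Suppose that
    [rho] is an injective homomorphism from Gamma to the additive group of a
    vector space [W] over a field [F]. Represent an edge [e] from a to b with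
    label alpha by the vector [(rho alpha, b - a)] of [W * F^V], where b - a
    is the signed incidence vector of [e], and let [M] be the linear matroid of
    these vectors.

    - The incidence vectors alone represent the graphic matroid over every
      field ([graphic_lin_indep]). Hence [M] is a lift of it: adjoining a basis
      of the kernel of the projection [W * F^V -> F^V] to the representation
      and then contracting that basis amounts to projecting
      ([lin_matroid_rank_lift]). The rank of the lift is the dimension of [W]
      as soon as the vectors of [M] span the kernel. In [K_n^Gamma] they do if
      [rho] has a spanning image, because two parallel edges with labels alpha
      and 1 differ by [(rho alpha, 0)] ([Kgraph_gain_rank_lift]).

    - Along a closed walk with total label gamma the signed vectors of the
      edges add up to [(rho gamma, 0)]. In a cycle any proper subset already
      has independent incidence vectors, so the only possible linear relation
      on the cycle is this signed sum, and the cycle is a circuit of [M]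
      exactly when gamma = 1 ([gain_circuit]).

    It remains to find [rho] with target [F^i], for every i between 1 and j.
    A field with j elements linearly independent over the prime field F_p is
    enough, for instance the rational functions F_p(X) with the powers of X:
    send x to the i-tuple whose k-th entry is the sum of the x_l X^l over the
    l congruent to k modulo i ([digit_row]). The entries use disjoint sets of
    coordinates, so [rho] is injective; and the unit vector number k < i is
    sent to X^k times a unit vector, so the image spans. *)

(** * Linear matroids *)

Section LinearMatroid.

Variables (F : fieldType) (vT : vectType F) (E : finType) (v : E -> vT).

Definition vspan (A : {set E}) : {vspace vT} := (\sum_(x in A) <[v x]>)%VS.

(** Dimension counting replaces families of coefficients: a set is independent
    when its span is as large as its cardinality allows, and in particular two
    elements with the same vector are dependent. *)
Definition lin_indep (A : {set E}) : bool := \dim (vspan A) == #|A|.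

Lemma mem_vspan (A : {set E}) x : x \in A -> v x \in vspan A.
Proof. by move=> xA; rewrite memvE (sumv_sup x). Qed.

Lemma vspan_subP (A : {set E}) (U : {vspace vT}) :
  reflect (forall x, x \in A -> v x \in U) (vspan A <= U)%VS.
Proof.
by apply: (iffP subv_sumP) => sAU x /sAU; rewrite -memvE.
Qed.

Lemma vspanS (A B : {set E}) : A \subset B -> (vspan A <= vspan B)%VS.
Proof. by move=> /subsetP sAB; apply/vspan_subP => x /sAB; apply: mem_vspan. Qed.

Lemma vspanU (A B : {set E}) : vspan (A :|: B) = (vspan A + vspan B)%VS.
Proof.
apply: subv_anti; rewrite subv_add !vspanS ?subsetUl ?subsetUr // !andbT.
apply/vspan_subP=> x /setUP[] /mem_vspan; apply: subvP.
  exact: addvSl.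
exact: addvSr.
Qed.

Lemma vspanU1 (A : {set E}) x : vspan (x |: A) = (<[v x]> + vspan A)%VS.
Proof. by rewrite vspanU [in vspan [set x]]/vspan big_set1. Qed.

Lemma vspanU1_id (A : {set E}) x : v x \in vspan A -> vspan (x |: A) = vspan A.
Proof. by rewrite memvE vspanU1 => /addv_idPr. Qed.

Lemma dim_vspan_le (A : {set E}) : \dim (vspan A) <= #|A|.
Proof.
rewrite -sum1_card; apply: leq_trans (dimv_leq_sum _ _ _) _.
by apply: leq_sum => x _; rewrite dim_vline leq_b1.
Qed.

Lemma dim_vspanU (A B : {set E}) : \dim (vspan (A :|: B)) <= #|A| + \dim (vspan B).
Proof.
rewrite vspanU (leq_trans (dimv_add_leqif _ _).1) //.
by rewrite leq_add2r dim_vspan_le.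
Qed.

Lemma lin_indep0 : lin_indep set0.
Proof. by rewrite /lin_indep /vspan big_set0 dimv0 cards0. Qed.

Lemma lin_indepS (A B : {set E}) : A \subset B -> lin_indep B -> lin_indep A.
Proof.
move=> sAB /eqP iB; rewrite /lin_indep eqn_leq dim_vspan_le /=.
have := dim_vspanU (B :\: A) A.
rewrite setUC -{1}(setIidPr sAB) setID iB -(cardsID A B) (setIidPr sAB).
by rewrite addnC leq_add2l.
Qed.

Lemma lin_indepU1 (A : {set E}) x :
  v x \notin vspan A -> lin_indep (x |: A) = lin_indep A.
Proof.
move=> vxA; have xA : x \notin A by apply: contra vxA; apply: mem_vspan.
have vx0 : v x != 0%R by apply: contraNneq vxA => ->; rewrite mem0v.
rewrite /lin_indep vspanU1 dimv_disjoint_sum; last first.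
  apply/eqP; rewrite -subv0; apply/subvP => y /memv_capP[/vlineP[k ->]].
  by rewrite rpredZeq (negPf vxA) orbF => /eqP->; rewrite scale0r mem0v.
by rewrite dim_vline vx0 cardsU1 xA eqn_add2l.
Qed.

Lemma lin_indepU1_mem (A : {set E}) x :
  x \notin A -> v x \in vspan A -> ~~ lin_indep (x |: A).
Proof.
move=> xA vxA; rewrite /lin_indep vspanU1_id // cardsU1 xA add1n.
by rewrite neq_ltn ltnS dim_vspan_le.
Qed.

(** Steinitz exchange: if every vector of [B] were in the span of [A], the
    span of [B] would have dimension at most #|A| < #|B|. *)
Lemma lin_indep_aug (A B : {set E}) :
  lin_indep A -> lin_indep B -> #|A| < #|B| ->
  exists2 x, x \in B :\: A & lin_indep (x |: A).
Proof.
move=> iA /eqP iB ltAB.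
have [/exists_inP[x xB vx]|/exists_inPn sBA] :=
    boolP [exists x in B, v x \notin vspan A].
  exists x; last by rewrite lin_indepU1.
  by rewrite inE xB andbT; apply: contra vx; apply: mem_vspan.
have /dimvS : (vspan B <= vspan A)%VS.
  by apply/vspan_subP => x /sBA /negbNE.
by rewrite iB => /leq_trans/(_ (dim_vspan_le A)); rewrite leqNgt ltAB.
Qed.

Definition lin_matroid : matroid E :=
  Matroid lin_indep0 lin_indepS lin_indep_aug.

Lemma rk_lin_matroid (A : {set E}) : rk lin_matroid A = \dim (vspan A).
Proof.
have [I [sIA /= iI cI]] := rk_witness lin_matroid A.
rewrite -cI -(eqP iI); apply/eqP; rewrite eqn_leq dimvS ?vspanS //=.
apply: dimvS; apply/vspan_subP => x xA; apply: contraT => vx.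
have ixI : indep lin_matroid (x |: I) by rewrite /= lin_indepU1.
have := indep_card_rk (_ : x |: I \subset A) ixI.
rewrite subUset sub1set xA sIA -cI cardsU1.
have -> : x \notin I by apply: contra vx; apply: mem_vspan.
by rewrite ltnn => /(_ isT).
Qed.

End LinearMatroid.

Section CircuitsAndImages.

Variables (F : fieldType) (vT wT : vectType F) (E : finType) (v : E -> vT).

(** Minimality only has to be tested on the sets obtained by removing one
    element, since independence is hereditary. *)
Lemma circuit_lin_matroid (C : {set E}) :
  (forall e, e \in C -> lin_indep v (C :\ e)) ->
  circuit (lin_matroid v) C = ~~ lin_indep v C.
Proof.
move=> iC; apply/minsetP/idP => [[]//|dC]; split=> // B dB sBC.
apply/eqP; rewrite eqEsubset sBC; apply/subsetP => e eC.
apply: contraNT dB => eB; apply: lin_indepS (iC e eC).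
by rewrite subsetD1 sBC eB.
Qed.

Variable f : 'Hom(vT, wT).

Lemma limg_vspan (A : {set E}) : (f @: vspan v A)%VS = vspan (f \o v) A.
Proof. by rewrite limg_sum; apply: eq_bigr => x _; rewrite limg_line. Qed.

Lemma lin_indep_image (A : {set E}) : lin_indep (f \o v) A -> lin_indep v A.
Proof.
rewrite /lin_indep eqn_leq => /andP[_ iA]; rewrite eqn_leq dim_vspan_le /=.
by rewrite (leq_trans iA) // -limg_vspan -(limg_ker_dim f (vspan v A)) leq_addl.
Qed.

End CircuitsAndImages.

(** * Lifts from linear projections *)

Section LinearLift.

Variables (F : fieldType) (vT wT : vectType F) (E : finType) (v : E -> vT).
Variables (f : 'Hom(vT, wT)) (M : matroid E).

Hypothesis indepM : indep M =1 lin_indep (f \o v).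

(* The ground set is enlarged by elements that carry a basis of [lker f]. *)
Let k := \dim (lker f).
Let T : finType := (E + 'I_k)%type.
Let u (x : T) : vT :=
  match x with inl e => v e | inr l => tnth (vbasis (lker f)) l end.
Let X : {set T} := [set inr l | l : 'I_k].

Let inlX e : inl e \notin X.
Proof. by apply/imsetP => -[]. Qed.

Let h (e : E) : {x : T | x \notin X} := Sub (inl e : T) (inlX e).

Let bij_h : bijective h.
Proof.
have inrX l : inr l \in X by apply: imset_f.
exists (fun x : {x : T | x \notin X} =>
  match val x as y return y \notin X -> E with
  | inl e => fun=> e
  | inr l => fun nX => False_rect E (negP nX (inrX l))
  end (valP x)).
  by [].
case=> -[e|l] nX /=; last by case: (negP nX (inrX l)).
exact: val_inj.
Qed.

Let val_h (A : {set E}) : val @: (h @: A) = [set inl e | e in A].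
Proof. by rewrite -imset_comp. Qed.

Let vspan_inl (A : {set E}) : vspan u [set inl e | e in A] = vspan v A.
Proof. by rewrite /vspan big_imset //= => x y _ _ []. Qed.

Let vspan_X : vspan u X = lker f.
Proof.
rewrite /vspan big_imset /=; last by move=> x y _ _ [].
by rewrite -[RHS](span_basis (vbasisP (lker f))) span_def big_tuple.
Qed.

(** Deleting the new elements leaves the matroid of [v]. Contracting them
    divides by the kernel of [f]: the span of [v A] and [lker f] meets [lker f]
    in all of it and has the image [f (v A)], so its dimension exceeds that of
    [lker f] by the dimension of the span of [f (v A)]. *)
Lemma lin_matroid_lift : is_lift (lin_matroid v) M.
Proof.
exists T, (lin_matroid u), X, h; split; split; try exact: bij_h.
  move=> A; rewrite /= /delete_indep /= val_h /lin_indep vspan_inl.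
  by rewrite card_imset // => x y [].
move=> A; rewrite indepM /= /contract_indep val_h !rk_lin_matroid vspanU.
rewrite vspan_inl vspan_X -(limg_ker_dim f (_ + _)%VS).
have -> : ((vspan v A + lker f) :&: lker f = lker f)%VS.
  by apply/capv_idPr; apply: addvSr.
have -> : (f @: (vspan v A + lker f) = vspan (f \o v) A)%VS.
  rewrite limgD limg_vspan; apply/addv_idPl.
  by rewrite (_ : (f @: lker f = 0)%VS) ?sub0v //; apply/eqP; rewrite -lkerE.
by rewrite addnC eqn_add2r card_imset //; apply: bij_inj bij_h.
Qed.

(** The rank of the lift is in general the dimension of the intersection of
    [lker f] with the span of all the vectors; the hypothesis makes this
    intersection equal to [lker f]. *)
Lemma lin_matroid_rank_lift :
  (lker f <= vspan v [set: E])%VS -> is_rank_lift k (lin_matroid v) M.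
Proof.
move=> sKv; split; first exact: lin_matroid_lift.
have -> : rank M = rank (lin_matroid (f \o v)).
  by apply: eq_bigl => A; rewrite indepM.
rewrite /rank !rk_lin_matroid -limg_vspan addnC.
by rewrite -(limg_ker_dim f (vspan v _)) (capv_idPr sKv).
Qed.

End LinearLift.

(** * Incidence vectors and closed walks *)

Section Walks.

Variables (V E : finType) (G : multigraph V E).

Lemma closed_walk_rot (w : seq (E * bool)) e :
  simple_closed_walk G w -> e \in wedges w ->
  exists d w', [/\ perm_eq w (d :: w'), d.1 = e, wedges w' = wedges w :\ e &
                   simple_closed_walk G (d :: w')].
Proof.
case/and4P=> _ cw us uw; rewrite inE => /mapP[d dw ->].
have [k w' rw] := rot_to dw.
have pw : perm_eq w (d :: w') by rewrite -rw perm_sym perm_rot.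
have cdw : simple_closed_walk G (d :: w').
  by rewrite /simple_closed_walk -rw rot_cycle !map_rot !rot_uniq us uw cw rw.
exists d, w'; split=> //; apply/setP=> x.
have /and4P[_ _ _ /= /andP[dw' _]] := cdw.
rewrite !inE (perm_mem (perm_map fst pw)) inE.
by case: eqP => // ->; apply: negPf.
Qed.

(** Along a walk each dart ends where the next one starts, so the list of ends
    is the list of starts shifted by one position. *)
Lemma path_dtgt d w : path (fun d d' => dtgt G d == dsrc G d') d w ->
  map (dtgt G) (d :: w) = rcons (map (dsrc G) w) (dtgt G (last d w)).
Proof. by elim: w d => //= d' w IHw d /andP[/eqP -> /IHw <-]. Qed.

Variables (F : fieldType).
Local Open Scope ring_scope.

(** A condition on the ends of an edge that does not depend on their order may
    be tested on either dart of the edge. *)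
Lemma ends_of_dart (P : V -> V -> Prop) (d : E * bool) :
  (P (src G d.1) (tgt G d.1) <-> P (tgt G d.1) (src G d.1)) ->
  P (dsrc G d) (dtgt G d) -> P (src G d.1) (tgt G d.1).
Proof. by rewrite /dsrc /dtgt; case: d.2 => // -[]. Qed.

Definition dart_vec (vT : zmodType) (v : E -> vT) (d : E * bool) : vT :=
  if d.2 then v d.1 else - v d.1.

Lemma dart_vec_span (vT : vectType F) (v : E -> vT) (w : seq (E * bool)) :
  \sum_(d <- w) dart_vec v d \in vspan v (wedges w).
Proof.
rewrite big_seq; apply: memv_suml => -[e b] dw; rewrite /dart_vec.
have ve : v e \in vspan v (wedges w) by rewrite mem_vspan // inE (map_f fst dw).
by case: b {dw} => /=; rewrite ?memvN.
Qed.

(** In a vanishing signed sum over a closed walk each edge occurs once and with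
    coefficient 1 or -1, so any of its vectors can be isolated. *)
Lemma closed_walk_dep (vT : vectType F) (v : E -> vT) w e :
  simple_closed_walk G w -> \sum_(d <- w) dart_vec v d = 0 ->
  e \in wedges w -> v e \in vspan v (wedges w :\ e).
Proof.
move=> cw sw /(closed_walk_rot cw)[d [w' [pw <- <- _]]].
move: sw; rewrite (perm_big _ pw) big_cons /= => /eqP.
rewrite addr_eq0 => /eqP dE.
have : dart_vec v d \in vspan v (wedges w') by rewrite dE memvN dart_vec_span.
by rewrite /dart_vec; case: d.2; rewrite ?memvN.
Qed.

Definition inc (e : E) : {ffun V -> F^o} :=
  [ffun x => (x == tgt G e)%:R - (x == src G e)%:R].

(** A function [c] on the vertices, regarded as a linear form on [F^V]. On
    incidence vectors it gives the coboundary of [c]. *)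
Definition pairing (c : V -> F) (g : {ffun V -> F^o}) : F^o :=
  \sum_x c x * g x.

Fact pairing_is_linear c : linear (pairing c).
Proof.
move=> a g g'; rewrite /pairing scaler_sumr -big_split.
by apply: eq_bigr => x _; rewrite !ffunE mulrDr mulrCA.
Qed.

HB.instance Definition _ c :=
  GRing.isLinear.Build F {ffun V -> F^o} F^o _ (pairing c) (pairing_is_linear c).

Lemma pairing_inc c e : pairing c (inc e) = c (tgt G e) - c (src G e).
Proof.
have cE y : \sum_x c x * (x == y)%:R = c y.
  rewrite (bigD1 y) //= eqxx mulr1 big1 ?addr0 // => x /negPf->.
  by rewrite mulr0.
rewrite -[c (tgt G e)]cE -[c (src G e)]cE -sumrB; apply: eq_bigr => x _.
by rewrite ffunE mulrBr.
Qed.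

(** A potential [c] that is constant along the edges of [A] but not along [e]
    is a linear form that vanishes on the span of [A] and not on [e]. *)
Lemma inc_notin_span (c : V -> F) (A : {set E}) e :
  (forall x, x \in A -> c (src G x) = c (tgt G x)) ->
  c (src G e) != c (tgt G e) -> inc e \notin vspan inc A.
Proof.
move=> cA ce; have sAK : (vspan inc A <= lker (linfun (pairing c)))%VS.
  apply/vspan_subP => x /cA cx.
  by rewrite memv_ker lfunE /= pairing_inc cx subrr.
apply/negP => /(subvP sAK); rewrite memv_ker lfunE /= pairing_inc subr_eq0.
by rewrite eq_sym (negPf ce).
Qed.

Lemma inc_dart d :
  dart_vec inc d = [ffun x => (x == dtgt G d)%:R - (x == dsrc G d)%:R].
Proof.
apply/ffunP => x; rewrite /dart_vec /dtgt /dsrc; case: d.2; rewrite !ffunE //.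
by rewrite opprB.
Qed.

(** The sum telescopes: a closed walk enters each vertex as often as it leaves
    it. *)
Lemma sum_inc_closed_walk w :
  simple_closed_walk G w -> \sum_(d <- w) dart_vec inc d = 0.
Proof.
case: w => // d w /and4P[_ /= cw _ _].
move: cw; rewrite rcons_path => /andP[/path_dtgt cw /eqP ld].
have pw : perm_eq (map (dtgt G) (d :: w)) (map (dsrc G) (d :: w)).
  by rewrite cw ld perm_rcons.
apply/ffunP => x; rewrite sum_ffunE ffunE.
under eq_bigr do rewrite inc_dart ffunE.
rewrite sumrB -(big_map (dtgt G) xpredT (fun y => (x == y)%:R)).
rewrite -(big_map (dsrc G) xpredT (fun y => (x == y)%:R)).
by rewrite (perm_big _ pw) subrr.
Qed.

(** The walk [w] visits its first vertex only once, so the indicator function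
    of that vertex separates the first edge of [w] from all the others. The
    dart [d] before [w] only names the vertex where [w] starts, which keeps the
    statement meaningful when [w] is empty. *)
Lemma lin_indep_inc_path d w :
  path (fun d d' => dtgt G d == dsrc G d') d w ->
  uniq (rcons (map (dsrc G) w) (dtgt G (last d w))) ->
  lin_indep inc (wedges w).
Proof.
elim: w d => [|d' w IHw] d.
  have -> : wedges ([::] : seq (E * bool)) = set0.
    by apply/setP=> x; rewrite !inE.
  by rewrite lin_indep0.
rewrite [path _ _ _]/= [last _ _]/= [map _ _]/= => /andP[_ pw].
rewrite rcons_cons -(path_dtgt pw) cons_uniq => /andP[d's ut].
have -> : wedges (d' :: w) = d'.1 |: wedges w.
  by apply/setP=> x; rewrite !inE.
rewrite lin_indepU1; first by apply: (IHw d'); rewrite // -path_dtgt.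
apply: (@inc_notin_span (fun x => (x == dsrc G d')%:R)).
  move=> x; rewrite inE => /mapP[d1 d1w ->].
  have ne1 : (dtgt G d1 == dsrc G d') = false.
    apply: contraNF d's => /eqP<-; apply: map_f.
    by rewrite inE d1w orbT.
  have ne2 : (dsrc G d1 == dsrc G d') = false.
    apply: contraNF d's => /eqP<-; rewrite (path_dtgt pw) mem_rcons inE.
    by rewrite map_f ?orbT.
  apply: (@ends_of_dart (fun x y => (x == _)%:R = (y == _)%:R :> F)).
    by split.
  by rewrite ne1 ne2.
have ne : (dtgt G d' == dsrc G d') = false.
  by apply: contraNF d's => /eqP<-; apply: map_f; rewrite mem_head.
apply: (@ends_of_dart (fun x y => (x == _)%:R != (y == _)%:R :> F)).
  by rewrite eq_sym.
by rewrite ne eqxx oner_eq0.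
Qed.

(** A cycle without one of its edges is a path. *)
Lemma lin_indep_inc_cycleD1 w e :
  simple_closed_walk G w -> e \in wedges w -> lin_indep inc (wedges w :\ e).
Proof.
move=> cw /(closed_walk_rot cw)[d [w' [_ _ <- /and4P[_ cw' us _]]]].
move: cw'; rewrite /= rcons_path => /andP[pw /eqP ld].
by apply: lin_indep_inc_path pw _; rewrite ld rcons_uniq -cons_uniq.
Qed.

(** The edges of a forest are added one at a time. The ends of the new edge
    lie in different components of the part already built, so the indicator
    function of one of these components separates the new edge from it.
    Conversely the signed sum along a cycle is a linear relation. *)
Lemma graphic_lin_indep : indep (graphic G) =1 lin_indep inc.
Proof.
move=> A /=; apply/idP/idP => [aA|iA].
  elim: {A}_.+1 {-2}A (ltnSn #|A|) aA => // m IHm A; rewrite ltnS => leAm aA.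
  have [->|[e eA]] := set_0Vmem A; first exact: lin_indep0.
  have DA := setD1K eA; rewrite -DA in aA *.
  have eB : e \notin A :\ e by rewrite !inE eqxx.
  have nuv := acyclic_disconnect eB aA.
  have aB : acyclic G (A :\ e).
    by apply: (@indepS _ (graphic G)) aA; apply: subsetUr.
  rewrite lin_indepU1; first by apply: IHm aB; rewrite (cardsD1 e A) eA in leAm.
  apply: (@inc_notin_span (fun x => (connect (adj G (A :\ e)) (src G e) x)%:R)).
    move=> x xB; congr (_ %:R); congr nat_of_bool.
    apply: same_connect_r; first exact: adj_connect_sym.
    by apply: connect1; exact: (@adj_dart _ _ G _ (x, true)).
  by rewrite connect0 (negPf nuv) oner_eq0.
apply/acyclicP => w cw; apply: contraL iA => sCA.
have [e ew] : exists e, e \in wedges w.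
  by case: w cw sCA => // d w _ _; exists d.1; rewrite inE mem_head.
apply: contra (@lin_indepS _ _ _ inc _ _ sCA) _.
rewrite -(setD1K ew) lin_indepU1_mem //; first by rewrite !inE eqxx.
exact: closed_walk_dep cw (sum_inc_closed_walk cw) ew.
Qed.

End Walks.

(** * The lift defined by an additive representation of the labels *)

Section GainGraph.

Variables (V E : finType) (G : multigraph V E) (gT : finGroupType).
Variables (phi : E -> gT) (F : fieldType) (wT : vectType F) (rho : gT -> wT).

Local Open Scope ring_scope.

Hypothesis rhoM : {morph rho : x y / (x * y)%g >-> x + y}.
Hypothesis rho_eq0 : forall x, rho x = 0 -> x = 1%g.

Local Notation pT := (wT * {ffun V -> F^o})%type.

Definition gain_vec (e : E) : pT := (rho (phi e), inc G F e).

Lemma rho1 : rho 1%g = 0.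
Proof. by apply: (addrI (rho 1%g)); rewrite -rhoM mulg1 addr0. Qed.

Lemma rhoV x : rho x^-1%g = - rho x.
Proof. by apply/eqP; rewrite -addr_eq0 -rhoM mulVg rho1. Qed.

Lemma sum_gain_vec w : simple_closed_walk G w ->
  \sum_(d <- w) dart_vec gain_vec d = (rho (walk_label phi w), 0).
Proof.
move=> cw; rewrite -(sum_inc_closed_walk F cw) /walk_label.
elim: w {cw} => [|d w IHw]; first by rewrite !big_nil rho1.
rewrite !big_cons IHw rhoM /dart_vec /gain_vec.
by case: d.2; rewrite ?rhoV.
Qed.

Definition drop_gain : 'Hom(pT, {ffun V -> F^o}) := linfun snd.

Lemma drop_gain_lin_indep (A : {set E}) :
  lin_indep (drop_gain \o gain_vec) A = lin_indep (inc G F) A.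
Proof.
rewrite /lin_indep /vspan; congr (\dim _ == _).
by apply: eq_bigr => e _; rewrite /= lfunE.
Qed.

Lemma mem_lker_drop_gain x : (x \in lker drop_gain) = (x.2 == 0).
Proof. by rewrite memv_ker lfunE. Qed.

Lemma dim_lker_drop_gain : \dim (lker drop_gain) = \dim {:wT}.
Proof.
have := limg_ker_dim drop_gain fullv; rewrite capfv.
have -> : (drop_gain @: fullv = fullv)%VS.
  apply/eqP; rewrite eqEsubv subvf; apply/subvP => y _.
  have -> : y = drop_gain (0, y) by rewrite lfunE.
  by rewrite memv_img ?memvf.
by rewrite !dimvf => /addIn.
Qed.

(** Balanced cycles are dependent because the signed sum along them vanishes.
    If a cycle is dependent, then its span is already spanned by the cycle
    without an edge [e]; that part has independent incidence vectors, so its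
    span meets the kernel of the projection only in 0, whereas it contains
    [(rho gamma, 0)] for the label gamma of any walk around the cycle. *)
Lemma gain_circuit (C : {set E}) : is_cycle G C ->
  circuit (lin_matroid gain_vec) C <-> balanced G phi C.
Proof.
case/is_cycleP => w0 cw0 wC.
have iC e : e \in C -> lin_indep (inc G F) (C :\ e).
  by rewrite -wC; apply: lin_indep_inc_cycleD1.
have iC' e : e \in C -> lin_indep gain_vec (C :\ e).
  move=> eC; apply: (@lin_indep_image _ _ _ _ _ drop_gain).
  by rewrite drop_gain_lin_indep iC.
have [e eC] : exists e, e \in C.
  rewrite -wC; case: w0 cw0 {wC} => // d w _.
  by exists d.1; rewrite inE mem_head.
have eCe : e \notin C :\ e by rewrite !inE eqxx.
rewrite circuit_lin_matroid //; split => [dC|[w [cw wC' l1]]]; last first.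
  rewrite -(setD1K eC) lin_indepU1_mem // -wC'.
  apply: (@closed_walk_dep _ _ G) => //; last by rewrite wC'.
  by rewrite sum_gain_vec // l1 rho1.
exists w0; split=> //; apply: rho_eq0.
set x := rho _; set S := vspan gain_vec (C :\ e).
have xS : (x, 0) \in S.
  rewrite /S -(@vspanU1_id _ _ _ _ _ e) ?setD1K //; last first.
    by apply: contraR dC => /lin_indepU1; rewrite setD1K // => ->; apply: iC'.
  by rewrite -wC -sum_gain_vec // dart_vec_span.
have S0 : (S :&: lker drop_gain)%VS = 0%VS.
  apply/eqP; rewrite -dimv_eq0 -(eqn_add2r (\dim (drop_gain @: S))).
  rewrite limg_ker_dim add0n limg_vspan (eqP (iC' e eC)).
  by have := iC e eC; rewrite -drop_gain_lin_indep => /eqP->.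
have : (x, 0) \in (S :&: lker drop_gain)%VS.
  by rewrite memv_cap xS mem_lker_drop_gain eqxx.
by rewrite S0 memv0 => /eqP[].
Qed.

End GainGraph.

(** Parallel edges with labels alpha and 1 differ by [(rho alpha, 0)], so the
    vectors of the edges span the kernel of the projection. *)
Lemma Kgraph_gain_rank_lift (n : nat) (gT : finGroupType) (F : fieldType)
    (wT : vectType F) (rho : gT -> wT) :
  2 <= n -> rho 1%g = 0%R -> vspan rho [set: gT] = fullv ->
  is_rank_lift (\dim {:wT})
    (lin_matroid (gain_vec (Kgraph n gT) (@Klabel n gT) rho))
    (graphic (Kgraph n gT)).
Proof.
move=> n2 rho_id rho_span; rewrite -(dim_lker_drop_gain 'I_n).
apply: lin_matroid_rank_lift.
  by move=> A; rewrite drop_gain_lin_indep; apply: graphic_lin_indep.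
apply/subvP => -[y z].
rewrite mem_lker_drop_gain => /eqP /= ->.
have: y \in vspan rho [set: gT] by rewrite rho_span memvf.
case/memv_sumP => ys ysP ->.
rewrite (big_morph (fun t => (t, 0%R)) (id1 := 0%R) (op1 := +%R)) //=; last first.
  by move=> t t'; congr pair; rewrite addr0.
apply: memv_suml => a aT; have /vlineP[k ->] := ysP a aT.
pose e b : Kedge n gT := (Sub (Ordinal (ltnW n2), Ordinal n2) isT, b).
have -> : (k *: rho a, 0)%R =
    (k *: (gain_vec (Kgraph n gT) (@Klabel n gT) rho (e a)
           - gain_vec (Kgraph n gT) (@Klabel n gT) rho (e 1%g)))%R.
  by congr pair; rewrite /= ?rho_id ?subr0 // subrr scaler0.
by rewrite memvZ // memvB // mem_vspan // in_setT.
Qed.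

(** * Spanning embeddings of elementary abelian groups *)

Section Embedding.

Local Open Scope ring_scope.

Variables (q j i : nat).
Hypothesis hi : (0 < i <= j)%N.

Local Notation F := {fraction {poly 'F_q}}.

(** Coordinate l of [x] contributes to entry l mod i of [digit_row x], as the
    coefficient of X^l. *)
Definition digit_poly (k : nat) (x : 'rV['F_q]_j) : {poly 'F_q} :=
  \sum_(l < j | (l %% i == k)%N) x 0 l *: 'X^l.

Definition digit_row (x : 'rV['F_q]_j) : 'rV[F]_i :=
  \row_k tofrac (digit_poly k x).

Lemma digit_rowD : {morph digit_row : x y / x + y}.
Proof.
move=> x y; apply/rowP => k; rewrite !mxE -tofracD -big_split; congr tofrac.
by apply: eq_bigr => l _; rewrite mxE scalerDl.
Qed.

(** Coordinate l of [x] is recovered as the coefficient of X^l in entry l mod i. *)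
Lemma digit_row_eq0 x : digit_row x = 0 -> x = 0.
Proof.
move=> x0; apply/rowP => l; rewrite mxE.
have ilt : (l %% i < i)%N by rewrite ltn_mod; case/andP: hi.
have /eqP := congr1 (fun z : 'rV_i => z 0 (Ordinal ilt)) x0.
rewrite !mxE tofrac_eq0 => /eqP /(congr1 (fun r : {poly _} => r`_l)).
rewrite coef0 coef_sum (bigD1 l) //= coefZ coefXn eqxx mulr1 big1 ?addr0 //.
move=> m /andP[_]; rewrite -val_eqE eq_sym coefZ coefXn => /negPf->.
by rewrite mulr0.
Qed.

(** For k < i the unit vector k of the domain contributes to entry k only, with
    the invertible scalar X^k. *)
Lemma digit_row_span : vspan digit_row [set: 'rV['F_q]_j] = fullv.
Proof.
apply/eqP; rewrite eqEsubv subvf; apply/subvP => y _.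
rewrite (row_sum_delta y); apply: memv_suml => k _; apply: memvZ.
have lkj : (k < j)%N by apply: leq_trans (ltn_ord k) _; case/andP: hi.
pose l := Ordinal lkj.
have Xk : tofrac ('X^k : {poly 'F_q}) != 0.
  by rewrite tofrac_eq0 -size_poly_eq0 size_polyXn.
suff /esym E : digit_row (delta_mx 0 l) = tofrac 'X^k *: delta_mx 0 k.
  have := mem_vspan digit_row (in_setT (delta_mx 0 l)).
  by rewrite -E rpredZeq (negPf Xk).
apply/rowP => m; rewrite !mxE /= /digit_poly big_mkcond (bigD1 l) //= big1 ?addr0.
  rewrite modn_small // mxE !eqxx /= scale1r.
  rewrite eq_sym -val_eqE /=; case: eqP => _; first by rewrite mulr1.
  by rewrite mulr0 tofrac0.
by move=> l' nl; rewrite mxE (negPf nl) /= scale0r; case: ifP.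
Qed.

End Embedding.

Theorem theorem1p3 (p n j i : nat) (hp : prime p) (hn : 3 <= n) (hj : 2 <= j)
    (hi : 1 <= i <= j) :
  exists M : matroid (Kedge n 'rV['Z_p]_j),
    is_rank_lift i M (graphic (Kgraph n 'rV['Z_p]_j)) /\
    forall C : {set Kedge n 'rV['Z_p]_j},
      is_cycle (Kgraph n 'rV['Z_p]_j) C ->
      (circuit M C <->
       balanced (Kgraph n 'rV['Z_p]_j) (@Klabel n 'rV['Z_p]_j) C).
Proof.
pose Q q := exists (F : fieldType) (rho : 'rV['Z_q]_j -> 'rV[F]_i),
  [/\ {morph rho : x y / (x + y)%R}, forall x, rho x = 0%R -> x = 0%R
    & vspan rho [set: 'rV['Z_q]_j] = fullv].
(* 'Z_(pdiv p) is the prime field 'F_p, and pdiv p = p *)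
have : Q (pdiv p).
  exists {fraction {poly 'F_p}}, (@digit_row p j i).
  by split; [apply: digit_rowD | apply: digit_row_eq0 | apply: digit_row_span].
rewrite pdiv_id // => -[F [rho [rhoD rho_eq0 rho_span]]].
exists (lin_matroid (gain_vec (Kgraph n _) (@Klabel n _) rho)); split.
  have := Kgraph_gain_rank_lift (ltnW hn) (rho1 rhoD) rho_span.
  by rewrite dimvf /dim /= mul1n.
by move=> C; apply: gain_circuit.
Qed.
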